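(* Let $R$ be a finite ring with $1$ and let $A$ be a finite unital left $R$-module that is pseudo-injective and whose socle $\operatorname{soc}(A)$ is a cyclic left $R$-module. Fix an injective homomorphism of left $R$-modules from $A$ into $\widehat{R}$, and use it to view $A$ as a left submodule of $\widehat{R}$. Let $w : A\to\mathbb{C}$ be a weight on $A$, and assume that $w$ is the restriction to $A$ of a bi-invariant weight $w' : \widehat{R}\to\mathbb{C}$ on $\widehat{R}$ such that, for every nonzero right submodule $S\subseteq\widehat{R}$, $$\sum_{aR \subseteq S} w'(a)\,\mu(0,aR) \neq 0,$$ where the sum is over the cyclic right submodules $aR$ of $\widehat{R}$ contained in $S$, and $\mu$ is the Möbius function of the poset of cyclic right submodules of $\widehat{R}$. Then the weight $w$ on the alphabet $A$ has the extension property.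
   Context: Rings are associative with $1$, not necessarily commutative. $\mathcal{U}$ denotes the group of units of $R$. $\widehat{R}$ is the group of complex characters $\pi : (R,+) \to \mathbb{C}^\times$; it is an $R$-bimodule with left scalar multiplication $({}^s\pi)(r) = \pi(rs)$ and right scalar multiplication $(\pi^s)(r) = \pi(sr)$ for $r,s\in R$. Its group operation is treated as addition, so $0\in\widehat{R}$ is the trivial character, and the scalar multiplications are also written $s\pi$ and $\pi s$. A left $R$-module $A$ is pseudo-injective if for every left $R$-submodule $B\subseteq A$, every injective homomorphism $B\to A$ of left $R$-modules extends to a homomorphism $A\to A$ of left $R$-modules. The socle $\operatorname{soc}(A)$ is the submodule generated by all simple left $R$-submodules of $A$. When $\operatorname{soc}(A)$ is cyclic, $A$ is known to embed into $\widehat{R}$ as a left $R$-module. A weight on $A$ (or on $\widehat{R}$) is a complex-valued function that vanishes at $0$. A weight $w'$ on $\widehat{R}$ is bi-invariant if $w'(uav)=w'(a)$ for all $a\in\widehat{R}$ and $u,v\in\mathcal{U}$. Let $P=\{aR : a\in \widehat{R}\}$ be the set of all cyclic right submodules of $\widehat{R}$, partially ordered by inclusion, with Möbius function $\mu$: $\mu(aR,cR)=0$ when $aR\not\subseteq cR$; $\mu(aR,aR)=1$; and $\sum_{aR\subseteq bR\subseteq cR}\mu(aR,bR)=0$ (sum over $bR\in P$) for $aR\subsetneq cR$. It is known that $aR=bR$ if and only if $a\,\mathcal{U}=b\,\mathcal{U}$, so for bi-invariant $w'$ the value $w'(a)$ depends only on $aR$. A weight $w$ on $A$ is extended to $A^n$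 by $w(x)=\sum_{i=1}^n w(x_i)$. $\mathrm{GL}_R(A)$ is the group of invertible left $R$-module homomorphisms $\phi:A\to A$, with inputs written on the left: $a\mapsto a\phi$. The right symmetry group of $w$ is $G_{\mathrm{rt}}=\{\phi\in\mathrm{GL}_R(A): w(a\phi)=w(a)\text{ for all } a\in A\}$. A $G_{\mathrm{rt}}$-monomial transformation of $A^n$ is an invertible homomorphism $T:A^n\to A^n$ of the form $(x_1,\dots,x_n)T=(x_{\sigma(1)}\phi_1,\dots,x_{\sigma(n)}\phi_n)$ with $\sigma$ a permutation of $\{1,\dots,n\}$ and $\phi_i\in G_{\mathrm{rt}}$. The weight $w$ on $A$ has the extension property if for every $n$, every left $R$-submodule $C\subseteq A^n$ and every injective homomorphism $f:C\to A^n$ of left $R$-modules with $w(f(c))=w(c)$ for all $c\in C$, the map $f$ extends to a $G_{\mathrm{rt}}$-monomial transformation of $A^n$. *)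

(* Defs.v *)
From HB Require Import structures.
From mathcomp Require Import all_boot all_order all_algebra all_fingroup.
From mathcomp Require Import reals complex.

Set Implicit Arguments.
Unset Strict Implicit.
Unset Printing Implicit Defensive.

Import GRing.Theory.
Local Open Scope ring_scope.

Section Dual.
Variables (K : realType) (R : finPzRingType).

Definition is_character (f : {ffun R -> K[i]}) : bool :=
  [forall r, f r != 0] && [forall r, forall s, f (r + s) == f r * f s].

Record dual := Dual { dual_fun :> {ffun R -> K[i]}; _ : is_character dual_fun }.

HB.instance Definition _ := [isSub for dual_fun].
HB.instance Definition _ := [Choice of dual by <:].

Lemma dualP (a b : dual) : (forall r, a r = b r) -> a = b.
Proof. by move=> eq_ab; apply/val_inj/ffunP. Qed.

Lemma is_characterP (f : {ffun R -> K[i]}) :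
  reflect ((forall r, f r != 0) /\ (forall r s, f (r + s) = f r * f s))
          (is_character f).
Proof.
apply: (iffP andP) => [[/forallP f0 /forallP fD]|[f0 fD]].
  by split=> // r s; apply/eqP; move/forallP: (fD r).
by split; apply/forallP=> r //; apply/forallP=> s; rewrite fD.
Qed.

Lemma dual_neq0 (a : dual) r : a r != 0.
Proof. by case/is_characterP: (valP a). Qed.

Lemma dualD (a : dual) r s : a (r + s) = a r * a s.
Proof. by case/is_characterP: (valP a). Qed.

Lemma dual0 (a : dual) : a 0 = 1.
Proof.
by apply: (mulfI (dual_neq0 a 0)); rewrite -dualD addr0 mulr1.
Qed.

(* [dual] is finite: the values of a character are #|R|-th roots of unity. *)
Definition unity_roots : seq K[i] :=
  sval (closed_field_poly_normal ('X^#|R| - 1 : {poly K[i]})).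

Lemma dual_unity_root (a : dual) r : a r \in unity_roots.
Proof.
have n_gt0: (0 < #|R|)%N by apply/card_gt0P; exists r.
have aMn m : a (r *+ m) = a r ^+ m.
  by elim: m => [|m IHm]; rewrite ?mulr0n ?dual0 // mulrS dualD IHm exprS.
have rn : r *+ #|R| = 0.
  have inj_r: injective (+%R r) by apply: addrI.
  have: \sum_(s : R) s = \sum_(s : R) (r + s).
    by rewrite (reindex_inj inj_r).
  rewrite big_split /= sumr_const => /esym/eqP.
  by rewrite -subr_eq0 addrK => /eqP.
have: root ('X^#|R| - 1 : {poly K[i]}) (a r).
  by rewrite rootE !hornerE -aMn rn dual0 subrr.
rewrite /unity_roots; case: closed_field_poly_normal => s /= def_s.
by rewrite {1}def_s lead_coefXnsubC // scale1r root_prod_XsubC.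
Qed.

Definition dual_code (a : dual) : {ffun R -> option (seq_sub unity_roots)} :=
  [ffun r => insub (a r)].

Definition dual_decode (h : {ffun R -> option (seq_sub unity_roots)}) :
    option dual :=
  insub [ffun r => if h r is Some z then ssval z else 0].

Lemma dual_codeK : pcancel dual_code dual_decode.
Proof.
move=> a; rewrite /dual_decode.
suff ->: [ffun r => if dual_code a r is Some z then ssval z else 0] = val a.
  exact: valK.
by apply/ffunP=> r; rewrite !ffunE (insubT (mem unity_roots) (dual_unity_root a r)).
Qed.

HB.instance Definition _ : isCountable dual := PCanIsCountable dual_codeK.
HB.instance Definition _ : isFinite dual := PCanIsFinite dual_codeK.

Fact zero_subproof : is_character [ffun => 1].
Proof.
by apply/is_characterP; split=> *; rewrite !ffunE ?oner_neq0 ?mulr1.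
Qed.
Definition dual_zero := Dual zero_subproof.

Fact opp_subproof (a : dual) : is_character [ffun r => (a r)^-1].
Proof.
apply/is_characterP; split=> *; rewrite !ffunE ?invr_neq0 ?dual_neq0 //.
by rewrite dualD invfM.
Qed.
Definition dual_opp a := Dual (opp_subproof a).

Fact add_subproof (a b : dual) : is_character [ffun r => a r * b r].
Proof.
apply/is_characterP; split=> *; rewrite !ffunE ?mulf_neq0 ?dual_neq0 //.
by rewrite !dualD mulrACA.
Qed.
Definition dual_add a b := Dual (add_subproof a b).

Fact lscale_subproof s (a : dual) : is_character [ffun r => a (r * s)].
Proof.
by apply/is_characterP; split=> *; rewrite !ffunE ?dual_neq0 // mulrDl dualD.
Qed.
Definition dual_lscale s a := Dual (lscale_subproof s a).

Fact rscale_subproof (a : dual) s : is_character [ffun r => a (s * r)].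
Proof.
by apply/is_characterP; split=> *; rewrite !ffunE ?dual_neq0 // mulrDr dualD.
Qed.
Definition rscale a s := Dual (rscale_subproof a s).

Fact dual_addA : associative dual_add.
Proof. by move=> a b c; apply: dualP => r; rewrite !ffunE mulrA. Qed.
Fact dual_addC : commutative dual_add.
Proof. by move=> a b; apply: dualP => r; rewrite !ffunE mulrC. Qed.
Fact dual_add0 : left_id dual_zero dual_add.
Proof. by move=> a; apply: dualP => r; rewrite !ffunE mul1r. Qed.
Fact dual_addN : left_inverse dual_zero dual_opp dual_add.
Proof. by move=> a; apply: dualP => r; rewrite !ffunE mulVf ?dual_neq0. Qed.

HB.instance Definition _ :=
  GRing.isZmodule.Build dual dual_addA dual_addC dual_add0 dual_addN.

Fact dual_lscaleA s t a :
  dual_lscale s (dual_lscale t a) = dual_lscale (s * t) a.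
Proof. by apply: dualP => r; rewrite !ffunE mulrA. Qed.
Fact dual_lscale1 : left_id 1 dual_lscale.
Proof. by move=> a; apply: dualP => r; rewrite !ffunE mulr1. Qed.
Fact dual_lscaleDr : right_distributive dual_lscale +%R.
Proof. by move=> s a b; apply: dualP => r; rewrite !ffunE. Qed.
Fact dual_lscaleDl a : {morph dual_lscale^~ a : s t / s + t}.
Proof. by move=> s t; apply: dualP => r; rewrite !ffunE mulrDr dualD. Qed.

HB.instance Definition _ := GRing.Zmodule_isLmodule.Build R dual
  dual_lscaleA dual_lscale1 dual_lscaleDr dual_lscaleDl.

Lemma rscaleA a s t : rscale (rscale a s) t = rscale a (s * t).
Proof. by apply: dualP => r; rewrite !ffunE mulrA. Qed.
Lemma rscale1 a : rscale a 1 = a.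
Proof. by apply: dualP => r; rewrite !ffunE mul1r. Qed.
Lemma rscaleDl s : {morph rscale^~ s : a b / a + b}.
Proof. by move=> a b; apply: dualP => r; rewrite !ffunE. Qed.
Lemma rscaleDr a : {morph rscale a : s t / s + t}.
Proof. by move=> s t; apply: dualP => r; rewrite !ffunE mulrDl dualD. Qed.
Lemma rscale_lscale s a t : s *: rscale a t = rscale (s *: a) t.
Proof. by apply: dualP => r; rewrite !ffunE mulrA. Qed.

Definition right_submod_closed (S : {set dual}) : Prop :=
  0 \in S /\ forall r, {in S &, forall a b, rscale a r + b \in S}.

Definition right_cyclic (a : dual) : {set dual} := [set rscale a r | r : R].

Definition right_cyclics : {set {set dual}} := [set right_cyclic a | a : dual].

Definition invertible (u : R) : Prop := exists v, v * u = 1 /\ u * v = 1.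

Definition bi_invariant (w : dual -> K[i]) : Prop :=
  forall u v a, invertible u -> invertible v -> w (rscale (u *: a) v) = w a.

(* The value at the cyclic submodule X of a bi-invariant weight, read off an
   arbitrary generator: aR = bR iff a and b are right associates. *)
Definition weight_at (w : dual -> K[i]) (X : {set dual}) : K[i] :=
  if [pick a | right_cyclic a == X] is Some a then w a else 0.

End Dual.

Section Moebius.
Variables (T : finType) (P : {set {set T}}).

Fixpoint moebius_rec (n : nat) (X Z : {set T}) : int :=
  if n is m.+1 then
    if X == Z then 1
    else if X \subset Z then
      - \sum_(Y in P | (X \subset Y) && (Y \proper Z)) moebius_rec m X Y
    else 0
  else 0.

(* Möbius function of P ordered by inclusion; the fuel #|Z|.+1 suffices since
   the recursive calls are at proper subsets of Z. *)
Definition moebius (X Z : {set T}) : int := moebius_rec #|Z|.+1 X Z.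

Lemma moebius_fuel n (X Z : {set T}) : (#|Z| < n)%N -> moebius_rec n X Z = moebius X Z.
Proof.
have rec_eq m k (Y : {set T}) :
    (#|Y| < m)%N -> (#|Y| < k)%N -> moebius_rec m X Y = moebius_rec k X Y.
  elim: m k Y => // m IHm [//|k] Y ltYm ltYk /=.
  do 2!case: ifP => // _; congr (- _); apply: eq_bigr => U.
  by case/and3P=> _ _ /proper_card ltUY; apply: IHm; apply: leq_trans ltUY _.
by move=> ltZn; apply: rec_eq.
Qed.

Lemma moebius_nsub (X Z : {set T}) : ~~ (X \subset Z) -> moebius X Z = 0.
Proof.
move=> nsXZ; rewrite /moebius /= (negPf nsXZ).
by case: eqP nsXZ => // ->; rewrite subxx.
Qed.

Lemma moebius_refl X : moebius X X = 1.
Proof. by rewrite /moebius /= eqxx. Qed.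

Lemma moebius_sum (X Z : {set T}) : Z \in P -> X \proper Z ->
  \sum_(Y in P | (X \subset Y) && (Y \subset Z)) moebius X Y = 0.
Proof.
move=> PZ ltXZ; have [neqXZ sXZ] := (proper_neq ltXZ, proper_sub ltXZ).
rewrite (bigD1 Z) /=; last by rewrite PZ sXZ subxx.
rewrite {1}/moebius /= (negPf neqXZ) sXZ addrC; apply/eqP; rewrite subr_eq0.
apply/eqP; apply: eq_big => [Y|Y].
  by rewrite properEneq -!andbA; congr [&& _, _ & _]; rewrite andbC.
case/andP=> /and3P[_ _ sYZ] neqYZ; rewrite moebius_fuel //.
by apply: proper_card; rewrite properEneq neqYZ.
Qed.

End Moebius.

Section Modules.
Variable R : pzRingType.
Implicit Types A V : lmodType R.

(* f restricts to a homomorphism on the submodule B. *)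
Definition linear_on V A (B : {pred V}) (f : V -> A) : Prop :=
  forall r, {in B &, forall x y, f (r *: x + y) = r *: f x + f y}.

Definition pseudo_injective A : Prop :=
  forall (B : {pred A}) (f : A -> A),
    GRing.submod_closed B -> linear_on B f -> {in B &, injective f} ->
    exists g : {linear A -> A}, {in B, g =1 f}.

Definition simple_submod A (S : {pred A}) : Prop :=
  [/\ GRing.submod_closed S,
      exists2 x, x \in S & x != 0 &
      forall B : {pred A}, GRing.submod_closed B -> {subset B <= S} ->
        B =i pred1 0 \/ B =i S].

Definition in_socle A (x : A) : Prop :=
  forall B : {pred A}, GRing.submod_closed B ->
    (forall S : {pred A}, simple_submod S -> {subset S <= B}) -> x \in B.

Definition socle_cyclic A : Prop :=
  exists a : A, forall x, in_socle x <-> exists r : R, x = r *: a.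

Section Weight.
Variables (C : nmodType) (A : lmodType R) (w : A -> C).

Definition right_symmetry (phi : {linear A -> A}) : Prop :=
  bijective phi /\ forall a, w (phi a) = w a.

Definition weight_ext n (x : {ffun 'I_n -> A}) : C := \sum_i w (x i).

Definition monomial n (T : {linear {ffun 'I_n -> A} -> {ffun 'I_n -> A}}) :
    Prop :=
  bijective T /\
  exists (sigma : 'S_n) (phi : 'I_n -> {linear A -> A}),
    (forall i, right_symmetry (phi i)) /\
    forall x i, T x i = phi i (x (sigma i)).

Definition extension_property : Prop :=
  forall n (B : {pred {ffun 'I_n -> A}})
         (f : {ffun 'I_n -> A} -> {ffun 'I_n -> A}),
    GRing.submod_closed B -> linear_on B f -> {in B &, injective f} ->
    {in B, forall x, weight_ext (f x) = weight_ext x} ->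
    exists T : {linear {ffun 'I_n -> A} -> {ffun 'I_n -> A}},
      monomial T /\ {in B, T =1 f}.

End Weight.
End Modules.

(* Main.v *)
Require Import Defs.
From HB Require Import structures.
From mathcomp Require Import all_boot all_order all_algebra all_fingroup.
From mathcomp Require Import reals complex.

(** The reduction. Let [C] be the code and consider, as functionals from [C] to
    the character module, its coordinates [lam i] and the coordinates [nu i] of
    the given isometry. Functionals on [C] form a right [R]-module. It suffices
    to match the cyclic right submodules generated by the [lam i] with those
    generated by the [nu i] ([functionals_permuted]): two functionals with the
    same right multiples have the same kernel on [C], and two maps from [C] to
    [A] with the same kernel differ by a symmetry of the weight
    ([symmetry_extension]).

    The matching. For functionals [f] and [g] let [<f, g>] be the sum of
    [w' (f x) * g x (-1)] over [x] in [C]. As the isometry preserves weights,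
    the sums of [<lam i, g>] and of [<nu i, g>] over [i] agree. Fourier
    inversion of [w'] and the orthogonality of characters on [C] show that
    [<f, g>] is, up to a nonzero constant, the sum of the Fourier transform of
    [w'] over all [r] with [f r = g] ([pairing_fourier]). Hence [<f, g>] vanishes
    unless [g] lies in [f R], so that the system of equations is triangular for
    the inclusion of cyclic submodules. A descending induction determines the
    multiplicities as soon as the diagonal entries [<g, g>] are nonzero.

    The diagonal. The entry [<g, g>] is a sum of the Fourier transform of [w']
    over a coset [1 + I], where the right ideal [I] is the annihilator of [g].
    Orthogonality turns sums over cosets of left ideals, not of right ideals,
    into sums of [w' a * a (-1)] over right submodules; because [mu(0, X)] is the
    sum of [a (-1)] over the generators [a] of [X] ([sum_generators]), the
    latter are the sums assumed to be nonzero. Passing from right to left is the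
    point of [sum_right_ideal_coset]: with a suitable idempotent [e] of [1 + I],
    a function invariant under multiplication by units on both sides has the
    same average on [1 + I] and on [1 + R (1 - e)].

    The units. Generators of the same cyclic module are right associates, and an
    isomorphism between submodules of [A] extends to the right multiplication by
    a unit of [R], which preserves [w'] by bi-invariance. Both facts are
    instances of one counting lemma on finite rings, [unit_in_coset]. *)

Set Implicit Arguments.
Unset Strict Implicit.
Unset Printing Implicit Defensive.

Import GRing.Theory Num.Theory.
Local Open Scope ring_scope.

(** * Finite rings *)

Section FiniteRing.
Variable R : finPzRingType.

Lemma right_inverse_invertible (u v : R) : u * v = 1 -> v * u = 1.
Proof.
move=> uv1; have inj_u : injective ( *%R^~ u).
  by move=> x y /(congr1 ( *%R^~ v)) /=; rewrite -!mulrA uv1 !mulr1.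
have [g _ gK] := injF_bij inj_u.
by rewrite -[v]mul1r -(gK 1) /= -(mulrA (g 1)) uv1 mulr1.
Qed.

Lemma invertible1 : @invertible R 1.
Proof. by exists 1; rewrite mulr1. Qed.

Lemma idempotent_power (t : R) : exists2 k, (0 < k)%N & t ^+ k * t ^+ k = t ^+ k.
Proof.
have /injectivePn[i [j neq_ij eq_ij]] :
    ~~ injectiveb (fun i : 'I_#|R|.+1 => t ^+ i).
  by apply/negP=> /injectiveP/leq_card; rewrite card_ord ltnn.
wlog lt_ij : i j neq_ij eq_ij / (i < j)%N.
  move=> wl; case: (ltngtP i j) => [||/val_inj eq_ij']; first exact: wl.
    by apply: wl; rewrite // eq_sym.
  by rewrite eq_ij' eqxx in neq_ij.
have period m d : (i <= m)%N -> t ^+ (m + d * (j - i)) = t ^+ m.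
  move=> le_im; elim: d => [|d IHd]; first by rewrite addn0.
  rewrite mulSnr addnA exprD IHd -exprD -{1}(subnK le_im) -addnA.
  by rewrite subnKC ?(ltnW lt_ij) // exprD -eq_ij -exprD subnK.
have d_gt0 : (0 < j - i)%N by rewrite subn_gt0.
exists (i.+1 * (j - i))%N; first by rewrite muln_gt0.
rewrite -exprD period //; apply: leq_trans (leqnSn i) _.
by rewrite leq_pmulr.
Qed.

(** Modulo [I], the elements [r] and [1] of the subring [E] generate the same
    right [E]-module. For [y] in [E], the number of [t] in [E] congruent to [y]
    modulo [I] with [t E = T] depends only on the right [E]-module generated by
    [y] modulo [I]: the [t] in [T] congruent to [y] are either absent or form a
    coset of the intersection of [T] and [I], and induction on [T] removes those
    that generate a smaller submodule. For [T = E] the count is positive at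
    [y = 1], hence at [y = r]. *)
Lemma unit_in_coset (E I : {set R}) (r s : R) :
    1 \in E -> {in E &, forall x y, x - y \in E} ->
    {in E &, forall x y, x * y \in E} ->
    {in I &, forall x y, x - y \in I} ->
    (forall x y, x \in I -> y \in E -> x * y \in I) ->
    r \in E -> s \in E -> r * s - 1 \in I ->
  exists u v, [/\ u \in E, v \in E, u * v = 1, v * u = 1 & u - r \in I].
Proof.
move=> E1 EB EM IB IE Er Es Irs.
have I0 : 0 \in I by rewrite -(subrr (r * s - 1)) IB.
have IN x : x \in I -> - x \in I by move=> Ix; rewrite -sub0r IB.
have ID x y : x \in I -> y \in I -> x + y \in I.
  by move=> Ix Iy; rewrite -[y]opprK IB ?IN.
have ED x y : x \in E -> y \in E -> x + y \in E.
  move=> Ex Ey; rewrite -[y]opprK EB // -sub0r EB //.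
  by rewrite -(subrr (1 : R)) EB.
pose gen (t : R) : {set R} := [set t * x | x in E].
have genE t : t \in E -> gen t \subset E.
  by move=> Et; apply/subsetP=> _ /imsetP[x Ex ->]; apply: EM.
have genP t : t \in gen t by apply/imsetP; exists 1; rewrite ?mulr1.
have gen_sub t t' : t \in E -> t' \in E -> (gen t' \subset gen t) = (t' \in gen t).
  move=> Et Et'; apply/idP/idP => [/subsetP-> //|/imsetP[x Ex ->]].
  by apply/subsetP=> _ /imsetP[y Ey ->]; rewrite -mulrA imset_f // EM.
pose lifts (y : R) (T : {set R}) := [set t in T | t - y \in I].
have le_lifts (y : R) y' c T : T \in [set gen t | t in E] -> c \in E ->
    y * c - y' \in I -> (#|lifts y T| <= #|lifts y' T|)%N.
  case/imsetP=> t Et -> Ec Ic.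
  have [->|[t0]] := set_0Vmem (lifts y (gen t)); first by rewrite cards0.
  rewrite inE => /andP[/imsetP[x0 Ex0 def_t0] It0].
  (* Translation by t0 c - t0 carries solutions for y to solutions for y'. *)
  rewrite -(card_imset _ (addIr (t0 * c - t0))); apply: subset_leq_card.
  apply/subsetP=> _ /imsetP[_ /setIdP[/imsetP[x Ex ->] Ix] ->].
  rewrite inE; apply/andP; split.
    apply/imsetP; exists (x + (x0 * c - x0)); first by rewrite ED // EB // EM.
    by rewrite def_t0 !(mulrDr, mulrN, mulrA).
  have -> : t * x + (t0 * c - t0) - y'
      = (t * x - y) - (t0 - y) + ((t0 - y) * c + (y * c - y')).
    by rewrite opprB mulrBl !addrA !subrK [t * x + _ - _]addrAC.
  exact: (ID _ _ (IB _ _ Ix It0) (ID _ _ (IE _ _ It0 Ec) Ic)).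
pose count (y : R) T := #|[set t in E | (t - y \in I) && (gen t == T)]|.
have count_lifts (y : R) (T : {set R}) : T \in [set gen t | t in E] ->
    #|lifts y T| = (\sum_(T' : {set R} | T' \subset T) count y T')%N.
  case/imsetP=> t Et ->.
  rewrite -sum1_card (partition_big gen (fun T' : {set R} => T' \subset gen t)) /=.
    apply: eq_bigr => T' sT'; rewrite sum1dep_card; apply: eq_card => x.
    rewrite !inE; apply/andP/and3P=> [[/andP[gx Ix] gxT]|[Ex Ix gxT]].
      by rewrite Ix gxT (subsetP (genE t Et)).
    by rewrite -gen_sub // (eqP gxT) sT' Ix.
  move=> x /setIdP[gx _]; rewrite gen_sub //.
  exact: (subsetP (genE t Et)).
have eq_count (T : {set R}) : count 1 T = count r T.
  elim: {T}_.+1 {-2}T (ltnSn #|T|) => // m IHm T ltTm.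
  have [cycT|/negP ncycT] := boolP (T \in [set gen t | t in E]); last first.
    have count0 y : count y T = 0%N.
      apply/eqP; rewrite cards_eq0 -subset0; apply/subsetP=> t /setIdP[Et].
      by case/andP=> _ /eqP def_T; case: ncycT; rewrite -def_T imset_f.
    by rewrite !count0.
  have : #|lifts 1 T| = #|lifts r T|.
    apply/anti_leq/andP; split; last exact: (le_lifts r 1 s).
    by apply: (le_lifts 1 r r); rewrite // mul1r subrr.
  rewrite !count_lifts // (bigD1 T) //= [RHS](bigD1 T) //=.
  rewrite (eq_bigr (count r)); first by move/addIn.
  move=> T' /andP[sT' neqT']; apply: IHm; rewrite -ltnS; apply: leq_trans ltTm.
  by rewrite ltnS; apply: proper_card; rewrite properEneq neqT'.
have : (0 < count r (gen 1%R))%N.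
  rewrite -eq_count card_gt0; apply/set0Pn; exists 1.
  by rewrite inE E1 subrr I0 eqxx.
rewrite card_gt0 => /set0Pn[u /setIdP[Eu /andP[Iu /eqP gen_u]]].
have : 1 \in gen u by rewrite gen_u.
case/imsetP=> v Ev uv1; exists u, v; split=> //.
exact: right_inverse_invertible.
Qed.

(** Choose an idempotent [e] of the multiplicative monoid [1 + I] with [e R] as
    small as possible. For [r] in [1 + I], minimality makes [e r] act invertibly
    on [e R], so that [v = 1 - e + e r] is a unit, and
    [r = (e + (1 - e) r v^-1) v]. Since [1 + I] is stable under adding elements
    of [(1 - e) R], the average of [h] on [1 + I] is its average on
    [e + (1 - e) R]. Multiplication by the units [1 + n] with [n] of square zero
    shows that [h] has the same average on [e + (1 - e) R] and on
    [e + R (1 - e)]: both reduce to [e + (1 - e) R (1 - e)]. *)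
Lemma sum_right_ideal_coset (F : pzRingType) (h : R -> F) (I : {set R}) :
    (forall u x, invertible u -> h (u * x) = h x /\ h (x * u) = h x) ->
    {in I &, forall x y, x - y \in I} -> 0 \in I ->
    (forall x y, x \in I -> x * y \in I) ->
  exists e, [/\ e * e = e, 1 - e \in I &
    (\sum_(r | r - 1 \in I) h r) *+ #|R| =
    (\sum_y h (e + y * (1 - e))) *+ #|[set r | r - 1 \in I]|].
Proof.
move=> h_inv IB I0 IM.
have IN x : x \in I -> - x \in I by move=> Ix; rewrite -sub0r IB.
have ID x y : x \in I -> y \in I -> x + y \in I.
  by move=> Ix Iy; rewrite -[y]opprK IB ?IN.
pose D := [set r | r - 1 \in I].
have DM x y : x \in D -> y \in D -> x * y \in D.
  rewrite !inE => Dx Dy; have -> : x * y - 1 = (x - 1) * y + (y - 1).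
    by rewrite mulrBl mul1r addrA subrK.
  by rewrite ID // IM.
have D1 : 1 \in D by rewrite inE subrr.
have DX x k : x \in D -> x ^+ k \in D.
  by move=> Dx; elim: k => // k IHk; rewrite exprS DM.
pose rid (x : R) : {set R} := [set x * y | y : R].
have [e /andP[/eqP ee De] min_e] : {e | (e * e == e) && (e \in D) &
    forall f, f * f = f -> f \in D -> (#|rid e| <= #|rid f|)%N}.
  case: (@arg_minnP _ 1 (fun e => (e * e == e) && (e \in D)) (fun e => #|rid e|)).
    by rewrite mulr1 eqxx.
  by move=> e e_ok min_e; exists e => // f /eqP ff Df; apply: min_e; rewrite ff.
have Ie : 1 - e \in I by rewrite -opprB IN //; move: De; rewrite inE.
have e1e : e * (1 - e) = 0 by rewrite mulrBr mulr1 ee subrr.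
have ee1 : (1 - e) * e = 0 by rewrite mulrBl mul1r ee subrr.
have e1K : (1 - e) * (1 - e) = 1 - e by rewrite mulrBr ee1 mulr1 subr0.
have sq0 (n : R) : n * n = 0 -> invertible (1 + n).
  move=> nn; exists (1 - n); split.
    by rewrite mulrDr mulr1 mulrBl mul1r nn subr0 subrK.
  by rewrite mulrDl mul1r mulrBr mulr1 nn subr0 subrK.
have unit_v r : r \in D -> invertible (1 - e + e * r).
  move=> Dr; have Der : e * r \in D by apply: DM.
  have [[//|k] _ idk] := idempotent_power (e * r).
  set f := _ ^+ _ in idk; have ef : e * f = f by rewrite /f exprS !mulrA ee.
  have fe_id : (f * e) * (f * e) = f * e by rewrite mulrA -(mulrA f) ef idk.
  have sfe : rid (f * e) \subset rid e.
    apply/subsetP=> _ /imsetP[y _ ->]; rewrite -ef -!mulrA.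
    exact: imset_f.
  have feD : f * e \in D by rewrite DM // DX.
  have eq_rid : rid (f * e) = rid e.
    by apply/eqP; rewrite eqEcard sfe min_e.
  have : e \in rid (f * e) by rewrite eq_rid; apply/imsetP; exists 1; rewrite ?mulr1.
  case/imsetP=> y _ def_e.
  have fe : f * e = e by rewrite -[in LHS]ee mulrA {2}def_e mulrA fe_id -def_e.
  (* On e R, the power f is the identity, so g is an inverse of e r there. *)
  pose g := (e * r) ^+ k * e.
  have erg : e * r * g = e by rewrite /g mulrA -exprS fe.
  have eg : e * g = g.
    rewrite /g; case: (k) => [|m]; first by rewrite expr0 mul1r.
    by rewrite exprS !mulrA ee.
  have [w [_ w1]] : invertible (1 + e * r * (1 - e)).
    by apply: sq0; rewrite -!mulrA [(1 - e) * _]mulrA ee1 mul0r !mulr0.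
  have vw : (1 - e + e * r) * ((1 - e + g) * w) = 1.
    have dg : (1 - e) * g = 0 by rewrite -eg mulrA ee1 mul0r.
    rewrite mulrA -[RHS]w1; have: 1 - e + e = 1 by rewrite subrK.
    move: (1 - e) e1K dg => d dd dg de1; congr (_ * _).
    by rewrite mulrDl !mulrDr dd erg dg addr0 addrCA de1 addrC.
  by exists ((1 - e + g) * w); split; rewrite // right_inverse_invertible.
have h_left y : h (e + (1 - e) * y) = h (e + (1 - e) * y * (1 - e)).
  have ez : e * ((1 - e) * y) = 0 by rewrite mulrA e1e mul0r.
  set z := (1 - e) * y in ez *.
  have u_z : invertible (1 + z * e).
    by apply: sq0; rewrite mulrA -[z * e * z]mulrA ez mulr0 mul0r.
  rewrite -[RHS](h_inv _ _ u_z).1; congr h.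
  have ze : z * e * e = z * e by rewrite -mulrA ee.
  have zz : z * e * (z * (1 - e)) = 0 by rewrite -(mulrA z e) (mulrA e z) ez mul0r mulr0.
  have zD : z * (1 - e) + z * e = z by rewrite -mulrDr subrK mulr1.
  move: (z * e) (z * (1 - e)) ze zz zD => n x ne nx xn.
  by rewrite mulrDl mul1r mulrDr ne nx addr0 -addrA xn.
have h_right y : h (e + y * (1 - e)) = h (e + (1 - e) * y * (1 - e)).
  rewrite -mulrA; have ze : y * (1 - e) * e = 0 by rewrite -mulrA ee1 mulr0.
  set z := y * (1 - e) in ze *.
  have u_z : invertible (1 + e * z).
    by apply: sq0; rewrite mulrA -[e * z * e]mulrA ze mulr0 mul0r.
  rewrite -[RHS](h_inv _ _ u_z).2; congr h.
  have ez : e * (e * z) = e * z by rewrite mulrA ee.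
  have zz : (1 - e) * z * (e * z) = 0 by rewrite -(mulrA _ z) (mulrA z e) ze mul0r mulr0.
  have zD : (1 - e) * z + e * z = z by rewrite -mulrDl subrK mul1r.
  move: (e * z) ((1 - e) * z) ez zz zD => n x en xn nx.
  by rewrite mulrDr mulr1 mulrDl en xn addr0 -addrA nx.
exists e; split=> //.
have -> : \sum_y h (e + y * (1 - e)) = \sum_y h (e + (1 - e) * y).
  by apply: eq_bigr => y _; rewrite h_right -h_left.
have shift x : \sum_(r | r - 1 \in I) h r = \sum_(r | r - 1 \in I) h (r + (1 - e) * x).
  rewrite (reindex_inj (addIr ((1 - e) * x))) /=; apply: eq_bigl => r.
  have Ix : (1 - e) * x \in I by apply: IM.
  rewrite addrAC; apply/idP/idP=> [Irx|Ir]; last exact: ID.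
  by rewrite -[r - 1](addrK ((1 - e) * x)) IB.
rewrite -sumr_const (eq_bigr _ (fun x _ => shift x)) exchange_big /= -sumr_const.
rewrite big_set /=; apply: eq_bigr => r Ir.
have Dr : r \in D by rewrite inE.
have [v' [v'v vv']] := unit_v r Dr.
set v := 1 - e + e * r in v'v vv'.
rewrite (reindex_inj (addrI (- r))) /=.
have inj_v : injective ( *%R^~ v).
  by move=> x y /(congr1 ( *%R^~ v')); rewrite -!mulrA vv' !mulr1.
rewrite (reindex_inj inj_v) /=; apply: eq_bigr => y _.
have u_v : invertible v by exists v'.
rewrite -[RHS](h_inv _ _ u_v).2; congr h.
have ev : e * v = e * r by rewrite /v mulrDr e1e add0r mulrA ee.
rewrite [RHS]mulrDl ev -(mulrA _ y v) mulrDr mulrN addrA; congr (_ + _).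
by rewrite mulrBl mul1r opprB addrC subrK.
Qed.

End FiniteRing.

(** * Sums of characters *)

Lemma sum_character (V : zmodType) (F : idomainType) (C : seq V) (chi : V -> F) y :
    uniq C -> {in C &, forall x z, x + z \in C} ->
    {in C &, forall x z, chi (x + z) = chi x * chi z} ->
    y \in C -> chi y != 1 ->
  \sum_(x <- C) chi x = 0.
Proof.
move=> uniqC CD chiD Cy chi_y.
have permC : perm_eq C [seq y + x | x <- C].
  rewrite perm_sym; apply: uniq_perm; rewrite ?(map_inj_uniq (addrI y)) //.
  apply: (uniq_min_size _ _ _).2; rewrite ?size_map ?(map_inj_uniq (addrI y)) //.
  by move=> _ /mapP[x Cx ->]; apply: CD.
have : \sum_(x <- C) chi x = chi y * \sum_(x <- C) chi x.
  rewrite {1}(perm_big _ permC) big_map big_distrr /=.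
  by apply: eq_big_seq => x Cx; apply: chiD.
move/eqP; rewrite -subr_eq0 -{1}[\sum_(x <- C) _]mul1r -mulrBl mulf_eq0.
by rewrite subr_eq0 eq_sym (negPf chi_y) => /eqP.
Qed.

Section Characters.
Variables (K : realType) (R : finPzRingType).
Local Notation dual := (dual K R).
Implicit Types (a b : dual) (r s : R).

Lemma dual_addE a b r : (a + b) r = a r * b r. Proof. exact: ffunE. Qed.
Lemma dual_oppE a r : (- a) r = (a r)^-1. Proof. exact: ffunE. Qed.
Lemma dual_zeroE r : (0 : dual) r = 1. Proof. exact: ffunE. Qed.
Lemma dual_scaleE s a r : (s *: a) r = a (r * s). Proof. exact: ffunE. Qed.
Lemma rscaleE a s r : rscale a s r = a (s * r). Proof. exact: ffunE. Qed.
Lemma dual_evalN a r : a (- r) = (a r)^-1.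
Proof.
apply: (mulfI (dual_neq0 a r)).
by rewrite -dualD subrr dual0 mulfV ?dual_neq0.
Qed.

Lemma rscale0 a : rscale a 0 = 0.
Proof. by apply: (addrI (rscale a 0)); rewrite -rscaleDr !addr0. Qed.

Lemma rscale0l r : rscale (0 : dual) r = 0.
Proof. by apply: (addrI (rscale (0 : dual) r)); rewrite -rscaleDl !addr0. Qed.

Lemma rscaleB a r s : rscale a (r - s) = rscale a r - rscale a s.
Proof. by apply/eqP; rewrite eq_sym subr_eq -rscaleDr subrK. Qed.

Lemma card_ring_neq0 : #|R|%:R != 0 :> K[i].
Proof. by rewrite pnatr_eq0 -lt0n; apply/card_gt0P; exists 0. Qed.

Lemma dual_neq0_eval a : a != 0 -> exists r, a r != 1.
Proof.
move=> a_neq0; apply/existsP; rewrite -negb_forall.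
apply: contra a_neq0 => /forallP a1.
by apply/eqP/dualP => r; rewrite (eqP (a1 r)) dual_zeroE.
Qed.

Lemma sum_dual a : \sum_r a r = if a == 0 then #|R|%:R else 0.
Proof.
case: eqP => [->|/eqP a_neq0].
  by rewrite (eq_bigr (fun=> 1)) ?sumr_const // => r _; apply: dual_zeroE.
have [r ar] := dual_neq0_eval a_neq0.
rewrite -big_enum /=; apply: (@sum_character R _ (enum R) a r) => //.
- exact: enum_uniq.
- by move=> x y _ _; rewrite mem_enum.
- by move=> x y _ _; apply: dualD.
- by rewrite mem_enum.
Qed.

(** The character module is injective, with endomorphism ring [R]. With
    [psi x = phi x 1], the sum over all [r] and [x] of [(psi x)^-1 * iota x r]
    is the order of [R], coming from [x = 0]. So for some [r] the character
    [x |-> (psi x)^-1 * iota x r] has a nonzero sum and is trivial; then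
    [psi x = iota x r], which determines [phi] by linearity. *)
Lemma linear_to_dual (A : lmodType R) (s : seq A) (iota : {linear A -> dual})
    (phi : A -> dual) :
    (forall x, x \in s) -> injective iota ->
    (forall r x y, phi (r *: x + y) = r *: phi x + phi y) ->
  exists r, forall x, phi x = rscale (iota x) r.
Proof.
move=> s_all iota_inj phi_lin.
have phiD x y : phi (x + y) = phi x + phi y by rewrite -[x]scale1r phi_lin !scale1r.
have phi0 : phi 0 = 0 by apply: (addrI (phi 0)); rewrite -phiD !addr0.
have phiZ r x : phi (r *: x) = r *: phi x by rewrite -[r *: x]addr0 phi_lin phi0 addr0.
pose t := undup s; have t_all x : x \in t by rewrite mem_undup.
pose chi r x := (phi x 1)^-1 * iota x r.
have : \sum_r \sum_(x <- t) chi r x != 0.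
  rewrite exchange_big /= (bigD1_seq 0) ?undup_uniq //= [X in _ + X]big1 => [|x x_neq0].
    rewrite addr0 -big_distrr /= phi0 raddf0 dual_zeroE invr1 mul1r sum_dual eqxx.
    exact: card_ring_neq0.
  rewrite -big_distrr /= sum_dual -(raddf0 iota) (inj_eq iota_inj).
  by rewrite (negPf x_neq0) mulr0.
have [r sum_r _|all0] := pickP (fun r => \sum_(x <- t) chi r x != 0); last first.
  by rewrite big1 ?eqxx // => r _; apply/eqP; rewrite -[_ == _]negbK all0.
have chi1 x : chi r x = 1.
  apply/eqP; apply: contraR sum_r => chi_x; apply/eqP.
  apply: (sum_character (undup_uniq s) _ _ (t_all x) chi_x) => [//|y z _ _].
  by rewrite /chi phiD raddfD !dual_addE invfM mulrACA.
have phi1 x : phi x 1 = iota x r.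
  by apply: (mulfI (invr_neq0 (dual_neq0 (phi x) 1))); rewrite mulVf ?dual_neq0 // -(chi1 x).
exists r => x; apply: dualP => y.
have -> : phi x y = (y *: phi x) 1 by rewrite dual_scaleE mul1r.
by rewrite -phiZ phi1 linearZ dual_scaleE rscaleE.
Qed.

(** * The Fourier transform of a weight and the Möbius function *)

Definition fourier (w : dual -> K[i]) r := \sum_a w a * a (- r).

Lemma fourier_inversion w a : \sum_r fourier w r * a r = #|R|%:R * w a.
Proof.
rewrite (eq_bigr (fun r => \sum_b w b * (a - b) r)) => [|r _]; last first.
  rewrite /fourier big_distrl; apply: eq_bigr => b _ /=.
  by rewrite !ffunE dual_evalN -mulrA [_^-1 * _]mulrC.
rewrite exchange_big (bigD1 a) // -big_distrr subrr sum_dual eqxx.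
rewrite big1 => [|b neq_ba]; first by rewrite [LHS]addr0; apply: mulrC.
by rewrite -big_distrr sum_dual subr_eq0 eq_sym (negPf neq_ba); apply: mulr0.
Qed.

Lemma bi_invariant_l w u a : bi_invariant w -> invertible u -> w (u *: a) = w a.
Proof.
by move=> w_inv u_unit; rewrite -(rscale1 (u *: a)) w_inv //; apply: invertible1.
Qed.

Lemma bi_invariant_r w u a :
  bi_invariant w -> invertible u -> w (rscale a u) = w a.
Proof.
by move=> w_inv u_unit; rewrite -{1}(scale1r a) w_inv //; apply: invertible1.
Qed.

Lemma fourier_invariant w u r : bi_invariant w -> invertible u ->
  fourier w (u * r) = fourier w r /\ fourier w (r * u) = fourier w r.
Proof.
move=> w_inv [v [vu uv]]; have v_unit : invertible v by exists u.
split; rewrite /fourier.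
  have injR : injective (fun a : dual => rscale a v).
    by move=> a b /(congr1 (fun c => rscale c u)); rewrite !rscaleA vu !rscale1.
  rewrite (reindex_inj injR) /=; apply: eq_bigr => a _.
  by rewrite bi_invariant_r // rscaleE mulrN mulrA vu mul1r.
have injL : injective (fun a : dual => v *: a).
  by move=> a b /(congr1 ( *:%R u)); rewrite !scalerA uv !scale1r.
rewrite (reindex_inj injL) /=; apply: eq_bigr => a _.
by rewrite bi_invariant_l // dual_scaleE mulNr -mulrA uv mulr1.
Qed.

Lemma mem_right_cyclic a r : rscale a r \in right_cyclic a.
Proof. exact: imset_f. Qed.

Lemma right_cyclic_id a : a \in right_cyclic a.
Proof. by rewrite -{1}(rscale1 a) mem_right_cyclic. Qed.

Lemma sub_right_cyclic a b :
  (right_cyclic b \subset right_cyclic a) = (b \in right_cyclic a).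
Proof.
apply/idP/idP => [/subsetP-> //|/imsetP[r _ ->]]; first exact: right_cyclic_id.
by apply/subsetP=> _ /imsetP[s _ ->]; rewrite rscaleA mem_right_cyclic.
Qed.

Lemma right_cyclic0 : right_cyclic (0 : dual) = [set 0].
Proof.
apply/setP=> a; rewrite inE; apply/imsetP/eqP => [[r _ ->]|->].
  exact: rscale0l.
by exists 0; rewrite ?rscale0.
Qed.

Section Annihilator.
Variables (X : eqType) (C : seq X) (f : X -> dual).

Definition annihilator : {set R} := [set t | all (fun x => rscale (f x) t == 0) C].

Lemma annihilatorP t :
  reflect {in C, forall x, rscale (f x) t = 0} (t \in annihilator).
Proof.
rewrite inE; apply: (iffP allP) => ft x Cx; first exact/eqP/ft.
by rewrite ft.
Qed.

Lemma annihilator0 : 0 \in annihilator.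
Proof. by apply/annihilatorP=> x _; apply: rscale0. Qed.

Lemma annihilatorB : {in annihilator &, forall s t, s - t \in annihilator}.
Proof.
move=> s t /annihilatorP fs /annihilatorP ft; apply/annihilatorP=> x Cx.
by rewrite rscaleB fs // ft // subrr.
Qed.

Lemma annihilatorM s t : s \in annihilator -> s * t \in annihilator.
Proof.
move=> /annihilatorP fs; apply/annihilatorP=> x Cx.
by rewrite -rscaleA fs // rscale0l.
Qed.

Lemma annihilator_diff s t : s - t \in annihilator ->
  {in C, forall x, rscale (f x) s = rscale (f x) t}.
Proof.
move=> /annihilatorP fst x Cx; have := fst x Cx.
by rewrite rscaleB => /eqP; rewrite subr_eq0 => /eqP.
Qed.

End Annihilator.

(** The case of [unit_in_coset] in which [I] is the annihilator of [f]: generators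
    of the same cyclic right module are right associates. *)
Lemma associate_on (X : eqType) (C : seq X) (f g : X -> dual) r s :
    {in C, forall x, g x = rscale (f x) r} ->
    {in C, forall x, f x = rscale (g x) s} ->
  exists2 u, invertible u & {in C, forall x, g x = rscale (f x) u}.
Proof.
move=> gf fg.
have Irs : r * s - 1 \in annihilator C f.
  apply/annihilatorP=> x Cx.
  by rewrite rscaleB rscale1 -rscaleA -gf // -fg // subrr.
have [|||||||u [v [_ _ uv vu Iu]]] :=
  @unit_in_coset R setT _ r s _ _ _ _ _ _ _ Irs.
- by rewrite inE.
- by move=> x y; rewrite !inE.
- by move=> x y; rewrite !inE.
- exact: annihilatorB.
- by move=> x y Ix _; apply: annihilatorM.
- by rewrite inE.
- by rewrite inE.
exists u => [|x Cx]; first by exists v.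
by rewrite (annihilator_diff Iu) // gf.
Qed.

Lemma right_cyclic_associate a b : right_cyclic a = right_cyclic b ->
  exists2 u, invertible u & b = rscale a u.
Proof.
move=> eq_ab; have : b \in right_cyclic a by rewrite eq_ab right_cyclic_id.
have : a \in right_cyclic b by rewrite -eq_ab right_cyclic_id.
case/imsetP=> s _ a_bs /imsetP[r _ b_ar].
have [||u u_unit bu] := @associate_on _ [:: tt] (fun=> a) (fun=> b) r s.
- by move=> x _.
- by move=> x _.
by exists u => //; apply: (bu tt); rewrite inE.
Qed.

Lemma weight_at_cyclic w a : bi_invariant w -> weight_at w (right_cyclic a) = w a.
Proof.
move=> w_inv; rewrite /weight_at; case: pickP => [b /eqP eq_ba|/(_ a)]; last first.
  by rewrite eqxx.
have [u u_unit ->] := right_cyclic_associate eq_ba.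
by rewrite bi_invariant_r.
Qed.

Lemma sum_right_cyclic a : a != 0 -> \sum_(b in right_cyclic a) b (-1) = 0.
Proof.
move=> a_neq0; rewrite -big_enum /=.
have [r ar] := dual_neq0_eval a_neq0.
apply: (@sum_character dual _ (enum (right_cyclic a)) _ (rscale a (- r))).
- exact: enum_uniq.
- move=> b c; rewrite !mem_enum => /imsetP[s _ ->] /imsetP[t _ ->].
  by rewrite -rscaleDr mem_right_cyclic.
- by move=> b c _ _; rewrite dual_addE.
- by rewrite mem_enum mem_right_cyclic.
- by rewrite rscaleE mulrNN mulr1.
Qed.

(** Summed over the cyclic submodules of [X], the left side gives the sum of the
    character [a |-> a (-1)] over [X], which vanishes unless [X] is trivial. This
    is the recursion that defines the Möbius function. *)
Lemma sum_generators (X : {set dual}) : X \in right_cyclics K R ->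
  \sum_(a | right_cyclic a == X) a (-1) =
  (moebius (right_cyclics K R) (right_cyclic (0 : dual)) X)%:~R.
Proof.
elim: {X}_.+1 {-2}X (ltnSn #|X|) => // m IHm X ltXm PX.
have /imsetP[c _ defX] := PX.
have [c0 | c_neq0] := eqVneq c 0.
  rewrite defX c0 moebius_refl right_cyclic0 (big_pred1 0) ?dual_zeroE // => a.
  apply/eqP/eqP=> [eq_a0|->]; last exact: right_cyclic0.
  by apply/set1P; rewrite -eq_a0 right_cyclic_id.
have sub0 Y : Y \in right_cyclics K R -> right_cyclic (0 : dual) \subset Y.
  by case/imsetP=> b _ ->; rewrite sub_right_cyclic -(rscale0 b) mem_right_cyclic.
have lt0X : right_cyclic (0 : dual) \proper X.
  rewrite properE sub0 // defX sub_right_cyclic right_cyclic0 inE.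
  by rewrite c_neq0.
have sum_gen := sum_right_cyclic c_neq0; rewrite -defX in sum_gen.
have sum_mu := congr1 (fun z : int => z%:~R : K[i]) (moebius_sum PX lt0X).
rewrite rmorph_sum (bigD1 X) /= in sum_mu; last by rewrite PX subxx sub0.
rewrite (partition_big (@right_cyclic K R)
    (fun Y => (Y \in right_cyclics K R) && (Y \subset X))) in sum_gen; last first.
  by move=> a; rewrite defX sub_right_cyclic imset_f.
rewrite (bigD1 X) /= in sum_gen; last by rewrite PX subxx.
have in_gen (Y : {set dual}) a : Y \subset X -> right_cyclic a == Y -> a \in X.
  by move=> sYX /eqP eq_aY; rewrite (subsetP sYX) // -eq_aY right_cyclic_id.
rewrite (eq_bigl (fun a => right_cyclic a == X)) in sum_gen; last first.
  by move=> a; apply: andb_idl; apply: in_gen.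
have eq_tail :
    \sum_(Y | (Y \in right_cyclics K R) && (Y \subset X) && (Y != X))
       \sum_(a in X | right_cyclic a == Y) a (-1)
    = \sum_(Y | [&& Y \in right_cyclics K R, right_cyclic (0 : dual) \subset Y
                  & Y \subset X] && (Y != X))
        (moebius (right_cyclics K R) (right_cyclic (0 : dual)) Y)%:~R.
  apply: eq_big => [Y|Y /andP[/andP[PY sYX] neqYX]].
    by case PY: (Y \in _); rewrite //= sub0.
  rewrite -IHm //; first by apply: eq_bigl => a; apply: andb_idl; apply: in_gen.
  rewrite -ltnS; apply: leq_trans ltXm; rewrite ltnS.
  by apply: proper_card; rewrite properEneq neqYX.
apply: (addIr (\sum_(Y | (Y \in right_cyclics K R) && (Y \subset X) && (Y != X))
  \sum_(a in X | right_cyclic a == Y) a (-1))).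
by rewrite [LHS]sum_gen eq_tail [RHS]sum_mu.
Qed.

Lemma submodule_sum w (S : {set dual}) :
    bi_invariant w -> right_submod_closed S ->
  \sum_(a in S) w a * a (-1) =
  \sum_(X in right_cyclics K R | X \subset S)
     weight_at w X * (moebius (right_cyclics K R) (right_cyclic (0 : dual)) X)%:~R.
Proof.
move=> w_inv [S0 S_closed].
have S_cyclic a : a \in S -> right_cyclic a \subset S.
  move=> Sa; apply/subsetP=> _ /imsetP[r _ ->].
  by rewrite -[rscale a r]addr0 S_closed.
rewrite (partition_big (@right_cyclic K R)
    (fun X => (X \in right_cyclics K R) && (X \subset S))) => [|a Sa]; last first.
  by rewrite imset_f ?S_cyclic.
apply: eq_bigr => X /andP[PX sXS]; rewrite -sum_generators // big_distrr.
apply: eq_big => [a|a /andP[_ /eqP <-]]; last by rewrite weight_at_cyclic.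
apply: andb_idl => /eqP eq_aX.
by rewrite (subsetP sXS) // -eq_aX right_cyclic_id.
Qed.

Definition moebius_nonvanishing (w : dual -> K[i]) :=
  forall S : {set dual}, right_submod_closed S -> S != [set 0] ->
    \sum_(X in right_cyclics K R | X \subset S) weight_at w X
      * (moebius (right_cyclics K R) (right_cyclic (0 : dual)) X)%:~R != 0.

(** With the idempotent [e] of [sum_right_ideal_coset], the sum is up to a nonzero
    factor the one over [e + R (1 - e)]. By orthogonality, the sum over
    [e + R (1 - e)] becomes a sum over the right submodule of all [b] with
    [e b = b]. This submodule is nonzero because [a e = a]: the element
    [e (t a)] is nonzero when [a t <> 1]. *)
Lemma fourier_coset_sum_neq0 w (I : {set R}) a :
    bi_invariant w -> moebius_nonvanishing w ->
    {in I &, forall x y, x - y \in I} -> 0 \in I ->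
    (forall x y, x \in I -> x * y \in I) ->
    a != 0 -> (forall r, r \in I -> rscale a r = 0) ->
  \sum_(r | r - 1 \in I) fourier w r != 0.
Proof.
move=> w_inv w_sum IB I0 IM a_neq0 aI.
have [e [ee Ie sum_e]] :=
  sum_right_ideal_coset (fun u x => @fourier_invariant w u x w_inv) IB I0 IM.
have sumE : \sum_y fourier w (e + y * (1 - e))
    = #|R|%:R * \sum_(b in [set b : dual | e *: b == b]) w b * b (-1).
  rewrite exchange_big big_distrr [RHS]big_mkcond.
  apply: eq_bigr => b _; rewrite inE -big_distrr.
  rewrite (eq_bigr (fun y => b (- e) * (- ((1 - e) *: b)) y)) => [|y _]; last first.
    by rewrite opprD dualD dual_oppE dual_scaleE [b (- (y * _))]dual_evalN.
  rewrite -big_distrr sum_dual oppr_eq0 scalerBl scale1r subr_eq0 eq_sym.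
  case: eqP => [eb|_] /=; last by rewrite !mulr0.
  have -> : b (- e) = b (-1) by rewrite -{2}eb dual_scaleE mulN1r.
  by rewrite mulrA mulrC.
have D1 : (0 < #|[set r : R | (r - 1)%R \in I]|)%N.
  by apply/card_gt0P; exists (1 : R); rewrite inE subrr.
apply/eqP => sum0; move/eqP: sum_e; rewrite sum0 mul0rn eq_sym.
rewrite mulrn_eq0 -leqn0 leqNgt D1 sumE mulf_eq0 (negPf card_ring_neq0) submodule_sum //; last first.
  split=> [|r b c]; rewrite !inE ?scaler0 // => /eqP eb /eqP ec.
  by rewrite scalerDr rscale_lscale eb ec.
apply/negP/w_sum.
  split=> [|r b c]; rewrite !inE ?scaler0 // => /eqP eb /eqP ec.
  by rewrite scalerDr rscale_lscale eb ec.
have ae : rscale a e = a.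
  apply/eqP; rewrite eq_sym -subr_eq0 -{1}(rscale1 a) -rscaleB.
  by rewrite aI.
have [t at1] := dual_neq0_eval a_neq0.
apply: contra at1 => /eqP S0.
have : e *: (t *: a) \in [set b : dual | e *: b == b] by rewrite inE scalerA ee.
rewrite S0 => /set1P/(congr1 (fun b : dual => b 1)).
by rewrite dual_zeroE !dual_scaleE mul1r -rscaleE ae => ->.
Qed.

End Characters.

(** * Functionals on a finite code *)

Section Functionals.
Variables (K : realType) (R : finPzRingType) (V : lmodType R) (C : seq V).
Local Notation dual := (dual K R).
Hypotheses (uniqC : uniq C) (C0 : 0 \in C).
Hypothesis C_closed : forall r, {in C &, forall x y, r *: x + y \in C}.

Definition functional (f : V -> dual) :=
  forall r, {in C &, forall x y, f (r *: x + y) = r *: f x + f y}.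

(** The cyclic right submodule generated by [f], as a set of functions on the
    finite type of codewords: only the values of [f] on [C] matter. *)
Definition multiples (f : V -> dual) : {set {ffun seq_sub C -> dual}} :=
  [set [ffun t : seq_sub C => rscale (f (ssval t)) r] | r : R].

Lemma multiples_subP f g :
  reflect (exists r, {in C, forall x, g x = rscale (f x) r})
          (multiples g \subset multiples f).
Proof.
apply: (iffP idP) => [/subsetP sgf|[r gf]].
  have /sgf/imsetP[r _ /ffunP gf] : [ffun t => g (ssval t)] \in multiples g.
    by apply/imsetP; exists 1 => //; apply/ffunP=> t; rewrite !ffunE rscale1.
  by exists r => x Cx; have := gf (SeqSub Cx); rewrite !ffunE.
apply/subsetP=> _ /imsetP[s _ ->]; apply/imsetP; exists (r * s) => //.
by apply/ffunP=> t; rewrite !ffunE gf ?ssvalP // rscaleA.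
Qed.

Lemma multiples_associate f g : multiples f = multiples g ->
  exists2 u, invertible u & {in C, forall x, g x = rscale (f x) u}.
Proof.
move=> eq_fg.
have /multiples_subP[r gf] : multiples g \subset multiples f by rewrite eq_fg.
have /multiples_subP[s fg] : multiples f \subset multiples g by rewrite eq_fg.
exact: associate_on gf fg.
Qed.

Section Functional.
Variable f : V -> dual.
Hypothesis f_lin : functional f.

Lemma functionalD : {in C &, forall x y, f (x + y) = f x + f y}.
Proof. by move=> x y Cx Cy; have := f_lin 1 Cx Cy; rewrite !scale1r. Qed.

Lemma functional0 : f 0 = 0.
Proof. by apply: (addrI (f 0)); rewrite -functionalD // !addr0. Qed.

Lemma functionalZ r x : x \in C -> f (r *: x) = r *: f x.
Proof. by move=> Cx; have := f_lin r Cx C0; rewrite functional0 !addr0. Qed.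

End Functional.

Variable w : dual -> K[i].

Definition pairing (f g : V -> dual) := \sum_(x <- C) w (f x) * g x (-1).

(** Expanding [w] by Fourier inversion gives, for each [r], the sum over [C] of the
    character [x |-> f x r * g x (-1)]. If [f r] and [g] differ at [x], they give
    different values at some [s], and the character is nontrivial at [s x]. *)
Lemma pairing_fourier f g : functional f -> functional g ->
  #|R|%:R * pairing f g =
  (size C)%:R * \sum_(r | all (fun x => rscale (f x) r == g x) C) fourier w r.
Proof.
move=> f_lin g_lin; rewrite /pairing big_distrr /=.
under eq_bigr => x _ do rewrite mulrA -fourier_inversion big_distrl /=.
rewrite exchange_big big_distrr [RHS]big_mkcond /=; apply: eq_bigr => r _.
under eq_bigr => x _ do rewrite -mulrA.
rewrite -big_distrr /=; case: ifPn => [/allP all_r|/allPn[x Cx fg_x]].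
  rewrite mulrC; congr (_ * _).
  rewrite (eq_big_seq (fun=> 1)) => [|x Cx].
    by rewrite big_const_seq count_predT iter_addr_0.
  by rewrite -(eqP (all_r x Cx)) rscaleE mulrN1 dual_evalN mulfV ?dual_neq0.
have [s fg_s] : exists s, f x (r * s) != g x s.
  apply/existsP; rewrite -negb_forall; apply: contra fg_x => /forallP fg_s.
  by apply/eqP/dualP => s; rewrite rscaleE (eqP (fg_s s)).
have Csx : s *: x \in C by rewrite -[s *: x]addr0 C_closed.
rewrite (@sum_character _ _ C (fun y => f y r * g y (-1)) (s *: x)) ?mulr0 //.
- by move=> y z Cy Cz; rewrite -[y]scale1r C_closed.
- by move=> y z Cy Cz; rewrite !functionalD // !dual_addE mulrACA.
apply: contra fg_s; rewrite !functionalZ // !dual_scaleE mulN1r dual_evalN.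
by move/eqP/(congr1 ( *%R^~ (g x s))); rewrite mulfVK ?dual_neq0 // mul1r => ->.
Qed.

Lemma size_code_neq0 : (size C)%:R != 0 :> K[i].
Proof. by rewrite pnatr_eq0 size_eq0; case: C C0. Qed.

Lemma pairing_sub f g : functional f -> functional g ->
  pairing f g != 0 -> multiples g \subset multiples f.
Proof.
move=> f_lin g_lin; apply: contraR => not_sub; apply/eqP.
apply: (mulfI (card_ring_neq0 K R)); rewrite pairing_fourier // big_pred0 ?mulr0 // => r.
apply/negbTE; apply: contra not_sub => /allP fr.
by apply/multiples_subP; exists r => x Cx; rewrite (eqP (fr x Cx)).
Qed.

Hypothesis w_inv : bi_invariant w.
Hypothesis w_sum : moebius_nonvanishing w.

Lemma pairing_multiples f f' g :
  multiples f = multiples f' -> pairing f g = pairing f' g.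
Proof.
move=> eq_ff'; have [u u_unit f'u] := multiples_associate eq_ff'.
by apply: eq_big_seq => x Cx; rewrite f'u // bi_invariant_r.
Qed.

Lemma pairing_self f :
  functional f -> multiples f != multiples (fun=> 0) -> pairing f f != 0.
Proof.
move=> f_lin f_neq0.
have /allPn[x Cx fx] : ~~ all (fun x => f x == 0) C.
  apply: contra f_neq0 => /allP f0; rewrite eqEsubset.
  apply/andP; split; apply/multiples_subP; exists 0 => x Cx;
  by rewrite rscale0 // (eqP (f0 x Cx)).
apply/eqP => pair0; have := pairing_fourier f_lin f_lin.
rewrite pair0 mulr0 => /esym/eqP; rewrite mulf_eq0 (negPf size_code_neq0) /=.
apply/negP; rewrite (eq_bigl (fun r => r - 1 \in annihilator C f)) => [|r].
  apply: (fourier_coset_sum_neq0 w_inv w_sum _ _ _ fx).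
  - exact: annihilatorB.
  - exact: annihilator0.
  - exact: annihilatorM.
  - by move=> r /annihilatorP; apply.
rewrite inE; apply: eq_all => y.
by have -> := rscaleB (f y) r 1; rewrite rscale1 subr_eq0.
Qed.

(** The equations [sum_i <lam i, g> = sum_i <nu i, g>] determine the
    multiplicities of the submodules generated by the [lam i] and the [nu i],
    from large to small: for [g] generating [L], only submodules containing [L]
    contribute, and [L] itself with the nonzero coefficient [<g, g>]. The zero
    submodule escapes this argument; its multiplicity follows because both
    families have [n] members. *)
Lemma functionals_permuted n (lam nu : 'I_n -> V -> dual) :
    (forall i, functional (lam i)) -> (forall i, functional (nu i)) ->
    {in C, forall x, \sum_i w (lam i x) = \sum_i w (nu i x)} ->
  exists sigma : 'S_n, forall i, multiples (lam (sigma i)) = multiples (nu i).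
Proof.
move=> lam_lin nu_lin eq_w.
pose kap (j : 'I_n + 'I_n) := match j with inl i => lam i | inr i => nu i end.
have kap_lin j : functional (kap j) by case: j.
(* The pairing with g as a function of the submodule L alone. *)
pose entry g (L : {set {ffun seq_sub C -> dual}}) :=
  if [pick j | multiples (kap j) == L] is Some j then pairing (kap j) g else 0.
have entryE g j : pairing (kap j) g = entry g (multiples (kap j)).
  rewrite /entry; case: pickP => [j' /eqP eq_j|/(_ j)]; last by rewrite eqxx.
  exact: pairing_multiples.
pose mult (f : 'I_n -> V -> dual) L := #|[set i | multiples (f i) == L]|.
have sum_mult (f : 'I_n -> V -> dual) g :
    (forall i, pairing (f i) g = entry g (multiples (f i))) ->
  \sum_i pairing (f i) g = \sum_L entry g L *+ mult f L.
  move=> fE; rewrite (partition_big (multiples \o f) predT) //=.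
  apply: eq_bigr => L _; rewrite -sumr_const; apply: eq_big => [i|i /eqP <-] //.
  by rewrite inE.
have eq_sum g : \sum_L entry g L *+ mult lam L = \sum_L entry g L *+ mult nu L.
  rewrite -!sum_mult => [|i|i];
    try by [exact: (entryE g (inl i)) | exact: (entryE g (inr i))].
  rewrite /pairing exchange_big [RHS]exchange_big /=; apply: eq_big_seq => x Cx.
  by rewrite -!big_distrl eq_w.
have card_multiples_gt0 (f : V -> dual) : (0 < #|multiples f|)%N.
  apply/card_gt0P; exists [ffun t => rscale (f (ssval t)) 0].
  by apply/imsetP; exists 0.
have card_multiples0 : #|multiples (fun=> 0)| = 1%N.
  rewrite (_ : multiples _ = [set [ffun=> 0]]) ?cards1 //; apply/setP=> h; rewrite inE.
  apply/imsetP/eqP=> [[r _ ->]|->]; first by apply/ffunP=> t; rewrite !ffunE rscale0l.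
  by exists 0 => //; apply/ffunP=> t; rewrite !ffunE rscale0.
have eq_mult L : L != multiples (fun=> 0) -> mult lam L = mult nu L.
  elim: {L}_.+1 {-2}L (ltnSn (#|[set: {ffun seq_sub C -> dual}]| - #|L|)) => //.
  move=> m IHm L ltLm L_neq0.
  case: (pickP (fun j => multiples (kap j) == L)) => [j /eqP def_L|noL]; last first.
    have mult0 f k : (forall i, f i = kap (k i)) -> mult f L = 0%N.
      move=> fk; apply/eqP; rewrite cards_eq0 -subset0; apply/subsetP=> i.
      by rewrite inE fk noL.
    by rewrite (mult0 lam inl) // (mult0 nu inr).
  have := eq_sum (kap j); rewrite (bigD1 L) //= [RHS](bigD1 L) //=.
  rewrite (eq_bigr (fun L' => entry (kap j) L' *+ mult nu L')) => [/addIr|L' neqL].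
    rewrite -def_L -entryE -[LHS]mulr_natr -[RHS]mulr_natr => /(mulfI _).
    have pair_j : pairing (kap j) (kap j) != 0 by apply: pairing_self; rewrite ?def_L.
    by move/(_ pair_j)/eqP; rewrite eqr_nat => /eqP.
  have [->|entry_L] := eqVneq (entry (kap j) L') 0; first by rewrite !mul0rn.
  congr (_ *+ _); have ltLL' : L \proper L'.
    rewrite properEneq eq_sym neqL /=; move: entry_L; rewrite /entry.
    case: pickP => [j' /eqP <-|_]; last by rewrite eqxx.
    by rewrite -def_L; apply: pairing_sub.
  apply: IHm.
    rewrite -ltnS; apply: leq_trans ltLm; rewrite ltnS ltn_sub2l ?proper_card //.
    by apply: proper_sub_trans ltLL' _; apply: subsetT.
  apply: contraTneq (proper_card ltLL') => ->.
  by rewrite card_multiples0 -leqNgt -def_L.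
have sum_all f : (\sum_L mult f L = n)%N.
  rewrite -[RHS]card_ord -sum1_card (partition_big (multiples \o f) predT) //=.
  by apply: eq_bigr => L _; rewrite sum1dep_card.
have eq_mult_all L : mult lam L = mult nu L.
  have [->|] := eqVneq L (multiples (fun=> 0)); last exact: eq_mult.
  have := etrans (sum_all lam) (esym (sum_all nu)).
  rewrite (bigD1 (multiples (fun=> 0))) //= [RHS](bigD1 (multiples (fun=> 0))) //=.
  by rewrite (eq_bigr (mult nu)) => [/addIn|L' neqL]; last exact: eq_mult.
have : perm_eq [tuple multiples (nu i) | i < n] [tuple multiples (lam i) | i < n].
  have count_mult f L : count_mem L [tuple multiples (f i) | i < n] = mult f L.
    rewrite /mult cardE -size_filter /enum_mem -enumT size_filter /= count_map.
    by rewrite size_filter; apply: eq_count => i /=; rewrite !inE.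
  by apply/allP=> L _; rewrite /= !count_mult eq_mult_all.
case/tuple_permP=> sigma eq_sigma; exists sigma => i.
have := congr1 (fun s => nth set0 s i) eq_sigma.
by rewrite -!tnth_nth !tnth_mktuple.
Qed.

End Functionals.

(** * Extension of maps with a common kernel *)

Section Extension.
Variables (R : finPzRingType) (V A : lmodType R) (C : seq V).
Hypothesis (C0 : 0 \in C).
Hypothesis C_closed : forall r, {in C &, forall x y, r *: x + y \in C}.

Definition code_map (g : V -> A) :=
  forall r, {in C &, forall x y, g (r *: x + y) = r *: g x + g y}.

(** The value of [h] at a preimage under [g] does not depend on the preimage. *)
Lemma factor_injective g h : code_map g -> code_map h ->
    {in C, forall x, g x = 0 <-> h x = 0} ->
  exists k : A -> A,
    [/\ GRing.submod_closed [in [seq g x | x <- C]],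
        linear_on [in [seq g x | x <- C]] k,
        {in [in [seq g x | x <- C]] &, injective k} &
        {in C, forall x, k (g x) = h x}].
Proof.
move=> g_lin h_lin eq_ker.
have Cdiff x y : x \in C -> y \in C -> -1 *: x + y \in C by apply: C_closed.
have diff (f : V -> A) x y : code_map f -> x \in C -> y \in C ->
    f (-1 *: x + y) = f y - f x.
  by move=> f_lin Cx Cy; rewrite f_lin // scaleN1r addrC.
pose k y := h (nth 0 C (find (fun x => g x == y) C)).
have kg : {in C, forall x, k (g x) = h x}.
  move=> x Cx; rewrite /k; set x' := nth _ _ _.
  have has_x : has (fun x' => g x' == g x) C by apply/hasP; exists x.
  have Cx' : x' \in C by rewrite mem_nth // -has_find.
  have gx' : g x' = g x by apply/eqP; exact: (nth_find 0 has_x).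
  apply/eqP; rewrite -subr_eq0 -diff //.
  by apply/eqP/eq_ker; rewrite ?Cdiff // diff // gx' subrr.
exists k; split=> //.
- split=> [|r _ _ /mapP[x Cx ->] /mapP[y Cy ->]]; last first.
    by rewrite -g_lin // map_f // C_closed.
  apply/mapP; exists 0 => //; have := g_lin (-1) _ _ C0 C0.
  by rewrite scaler0 addr0 scaleN1r addNr => ->.
- move=> r _ _ /mapP[x Cx ->] /mapP[y Cy ->].
  by rewrite -g_lin // !kg ?C_closed // h_lin.
move=> _ _ /mapP[x Cx ->] /mapP[y Cy ->]; rewrite !kg // => eq_h.
apply/eqP; rewrite -subr_eq0 -diff //; apply/eqP/eq_ker; first exact: Cdiff.
by rewrite diff // eq_h subrr.
Qed.

Variables (K : realType) (s : seq A) (iota : {linear A -> dual K R}).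
Variables (w' : dual K R -> K[i]) (w : A -> K[i]).
Hypotheses (s_all : forall a, a \in s) (A_pinj : pseudo_injective A).
Hypotheses (iota_inj : injective iota) (w'_inv : bi_invariant w').
Hypothesis w_res : forall a, w a = w' (iota a).

Lemma rscale_map u : (forall x, exists y, iota y == rscale (iota x) u) ->
  exists phi : {linear A -> A}, forall x, iota (phi x) = rscale (iota x) u.
Proof.
move=> ex_y; pose phi x := xchoose (ex_y x).
have phiE x : iota (phi x) = rscale (iota x) u by apply/eqP/(xchooseP (ex_y x)).
have phi_lin : linear phi.
  move=> r x y; apply: iota_inj.
  by rewrite !linearP !phiE linearP rscaleDl rscale_lscale.
pose phi_mixin := GRing.isLinear.Build R A A _ phi phi_lin.
by exists (HB.pack_for {linear A -> A} phi phi_mixin).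
Qed.

(** Pseudo-injectivity gives endomorphisms of [A] that send [g] to [h] and [h] to
    [g]. Every endomorphism of [A] is the right multiplication by an element of
    [R] that maps [A] to itself. These elements form a subring [E], in which [r]
    and [t] realise the two endomorphisms and [r t] fixes the image of [g]. Some
    unit of [E] then agrees with [r] on this image, and bi-invariance makes it a
    symmetry of the weight. *)
Lemma symmetry_extension g h : code_map g -> code_map h ->
    {in C, forall x, g x = 0 <-> h x = 0} ->
  exists phi : {linear A -> A},
    right_symmetry w phi /\ {in C, forall x, phi (g x) = h x}.
Proof.
move=> g_lin h_lin eq_ker.
have [k [Bg k_lin k_inj kg]] := factor_injective g_lin h_lin eq_ker.
have eq_ker' : {in C, forall x, h x = 0 <-> g x = 0}.
  by move=> x Cx; apply: iff_sym; apply: eq_ker.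
have [l [Bh l_lin l_inj lh]] := factor_injective h_lin g_lin eq_ker'.
have [G Gk] := A_pinj Bg k_lin k_inj.
have [H Hl] := A_pinj Bh l_lin l_inj.
have ext_scale (F : {linear A -> A}) : exists r, forall x, iota (F x) = rscale (iota x) r.
  by apply: (linear_to_dual s_all iota_inj) => r x y; rewrite !linearP.
have [r Gr] := ext_scale G; have [t Ht] := ext_scale H.
have gr : {in C, forall x, rscale (iota (g x)) r = iota (h x)}.
  by move=> x Cx; rewrite -Gr Gk ?kg //; apply: map_f.
have ht : {in C, forall x, rscale (iota (h x)) t = iota (g x)}.
  by move=> x Cx; rewrite -Ht Hl ?lh //; apply: map_f.
pose E := [set q : R | all (fun x => rscale (iota x) q \in map iota s) s].
have EP q : reflect (forall x, exists y, iota y == rscale (iota x) q) (q \in E).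
  rewrite inE; apply: (iffP allP) => [Eq x | Eq x _].
    by have /mapP[y _ ->] := Eq x (s_all x); exists y.
  by have [y /eqP <-] := Eq x; apply: map_f.
have [|||||||u [v [/EP Eu /EP Ev uv vu Iu]]] :=
  @unit_in_coset R E (annihilator C (iota \o g)) r t _ _ _ (@annihilatorB _ _ _ _ _).
- by apply/EP => x; exists x; rewrite rscale1.
- move=> p q /EP Ep /EP Eq; apply/EP => x.
  have [[y /eqP py] [z /eqP qz]] := (Ep x, Eq x); exists (y - z).
  by rewrite linearB py qz -rscaleB.
- move=> p q /EP Ep /EP Eq; apply/EP => x.
  have [y /eqP py] := Ep x; have [z /eqP qz] := Eq y; exists z.
  by rewrite qz py rscaleA.
- by move=> p q Ip _; apply: annihilatorM.
- by apply/EP => x; exists (G x); rewrite Gr.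
- by apply/EP => x; exists (H x); rewrite Ht.
- apply/annihilatorP=> x Cx /=.
  by rewrite rscaleB rscale1 -rscaleA gr // ht // subrr.
have [phi phiE] := rscale_map Eu; have [psi psiE] := rscale_map Ev.
exists phi; split=> [|x Cx].
  split.
    by exists psi => x; apply: iota_inj; rewrite ?(phiE, psiE) rscaleA ?uv ?vu rscale1.
  by move=> a; rewrite !w_res phiE bi_invariant_r //; exists v.
by apply: iota_inj; rewrite phiE -gr // -(annihilator_diff Iu).
Qed.

End Extension.

(** * The extension property *)

Theorem theorem6p1 (K : realType) (R : finPzRingType) (A : lmodType R)
    (A_fin : exists s : seq A, forall a, a \in s)
    (A_pinj : pseudo_injective A) (A_soc : socle_cyclic A)
    (iota : {linear A -> dual K R}) (iota_inj : injective iota)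
    (w : A -> K[i]) (w0 : w 0 = 0)
    (w' : dual K R -> K[i]) (w'0 : w' 0 = 0)
    (w'_inv : bi_invariant w')
    (w_res : forall a : A, w a = w' (iota a))
    (w'_sum : forall S : {set dual K R},
        right_submod_closed S -> S != [set 0] ->
        \sum_(X in right_cyclics K R | X \subset S)
          weight_at w' X
          * (moebius (right_cyclics K R) (right_cyclic (0 : dual K R)) X)%:~R
        != 0) :
  extension_property w.
Proof.
have [s s_all] := A_fin; move=> n B f [B0 B_closed] f_lin f_inj f_w.
(* Each codeword occurs once, as character sums over the list require. *)
pose C := undup [seq x <- [seq [ffun i => ssval (y i)] | y : {ffun 'I_n -> seq_sub s}]
                | x \in B].
have memC x : (x \in C) = (x \in B).
  rewrite mem_undup mem_filter andb_idr // => _.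
  apply/imageP; exists [ffun i => SeqSub (s_all (x i))] => //.
  by apply/ffunP=> i; rewrite !ffunE.
have C0 : 0 \in C by rewrite memC.
have C_closed r : {in C &, forall x y, r *: x + y \in C}.
  by move=> x y; rewrite !memC; apply: B_closed.
have f_linC r : {in C &, forall x y, f (r *: x + y) = r *: f x + f y}.
  by move=> x y; rewrite !memC; apply: f_lin.
pose lam i (x : {ffun 'I_n -> A}) := iota (x i).
pose nu i (x : {ffun 'I_n -> A}) := iota (f x i).
have lam_lin i : functional C (lam i).
  by move=> r x y Cx Cy; rewrite /lam !ffunE linearP.
have nu_lin i : functional C (nu i).
  by move=> r x y Cx Cy; rewrite /nu f_linC // !ffunE linearP.
have eq_w : {in C, forall x, \sum_i w' (lam i x) = \sum_i w' (nu i x)}.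
  move=> x; rewrite memC => Bx; have := f_w x Bx; rewrite /weight_ext => /esym.
  by under eq_bigr do rewrite w_res; under [RHS]eq_bigr do rewrite w_res.
have [sigma eq_span] := functionals_permuted (undup_uniq _) C0 C_closed
  w'_inv w'_sum lam_lin nu_lin eq_w.
have ex_phi i : exists phi : {linear A -> A},
    right_symmetry w phi /\
      {in C, forall x : {ffun 'I_n -> A}, phi (x (sigma i)) = f x i}.
  apply: (symmetry_extension (g := fun x : {ffun 'I_n -> A} => x (sigma i)) (h := fun x => f x i)
    C0 C_closed s_all A_pinj iota_inj w'_inv w_res).
  - by move=> r x y _ _; rewrite !ffunE.
  - by move=> r x y Cx Cy; rewrite f_linC // !ffunE.
  have /multiples_subP[r nu_lam] : multiples C (nu i) \subset multiples C (lam (sigma i)).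
    by rewrite eq_span.
  have /multiples_subP[t lam_nu] : multiples C (lam (sigma i)) \subset multiples C (nu i).
    by rewrite eq_span.
  move=> x Cx; split=> x0; apply: iota_inj.
    by have := nu_lam x Cx; rewrite /nu /lam x0 linear0 rscale0l.
  by have := lam_nu x Cx; rewrite /nu /lam x0 linear0 rscale0l.
have [phi phiP] := fin_all_exists ex_phi.
have [psi psiP] : exists psi : 'I_n -> A -> A,
    forall i, cancel (phi i) (psi i) /\ cancel (psi i) (phi i).
  apply: (@fin_all_exists _ _ (fun i g => cancel (phi i) g /\ cancel g (phi i))) => i.
  by have [[[g phiK gK] _] _] := phiP i; exists g.
pose T (x : {ffun 'I_n -> A}) := [ffun i => phi i (x (sigma i))].
have T_lin : linear T by move=> r x y; apply/ffunP=> i; rewrite !ffunE linearP.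
pose T_mixin := GRing.isLinear.Build R _ _ _ T T_lin.
exists (HB.pack_for {linear {ffun 'I_n -> A} -> {ffun 'I_n -> A}} T T_mixin).
split; last first.
  by move=> x Bx; apply/ffunP=> i; rewrite /= ffunE (phiP i).2 ?memC.
split; last by exists sigma, phi; split=> [i|x i]; [case: (phiP i) | rewrite /= ffunE].
exists (fun y : {ffun 'I_n -> A} =>
  [ffun j => psi (sigma^-1%g j) (y (sigma^-1%g j))]) => x; apply/ffunP=> i.
  by rewrite !ffunE (psiP _).1 permKV.
by rewrite !ffunE permK (psiP _).2.
Qed.
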